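(* Let $J:C[0,1]\rightrightarrows rca[0,1]$ be the normalized duality mapping of the real Banach space $C[0,1]$. Let $f\in C^+[0,1]$ with $\|f\|>0$, and let $f^{**}\in rca^*[0,1]$ be the functional induced by $f$. For any $u\in C^+[0,1]$, if $\|u\|>\|f\|$ and $M(u)\cap M(f)\neq\emptyset$, then there are $\mu\in J(f)$ and $\lambda\in J(u)$ such that $$\lambda\notin\widehat{D}^*J(f,\mu)(f^{**}).$$
   Context: $C[0,1]$ is the Banach space of continuous real functions on $[0,1]$ with the maximum norm $\|\cdot\|$; its dual $C^*[0,1]=rca[0,1]$ is the space of regular countably additive real-valued measures on the Borel $\sigma$-field $\Sigma$ of $[0,1]$, with pairing $\langle\mu,f\rangle=\int_0^1 f(s)\,\mu(ds)$ and norm $\|\mu\|_*=v(\mu,[0,1])$, the total variation of $\mu$ (the dual norm). $rca^*[0,1]=C^{**}[0,1]$ is the dual of $rca[0,1]$, with pairing $\langle\cdot,\cdot\rangle_*$. $C^+[0,1]=\{f\in C[0,1]: f(s)\ge0\ \forall s\in[0,1]\}$. Each $f\in C^+[0,1]$ induces $f^{**}\in rca^*[0,1]$ by $\langle f^{**},\gamma\rangle_*=\langle\gamma,f\rangle$ for all $\gamma\in rca[0,1]$. For $f\in C[0,1]$, the maximizing set is $M(f)=\{t\in[0,1]:|f(t)|=\|f\|\}$. The normalized duality mapping is $J(f)=\{\mu\in rca[0,1]:\langle\mu,f\rangle=\|f\|^2=\|\mu\|_*^2\}$. For $\mu\in J(f)$, the Mordukhovich derivative of $J$ at $(f,\mu)$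 is defined, for $\Phi\in C^{**}[0,1]$, by $$\widehat{D}^*J(f,\mu)(\Phi)=\left\{\lambda\in rca[0,1]:\ \limsup_{(g,\gamma)\to(f,\mu),\ g\in C[0,1],\ \gamma\in J(g)}\frac{\langle\lambda,g-f\rangle-\langle\Phi,\gamma-\mu\rangle_*}{\|g-f\|+\|\gamma-\mu\|_*}\le0\right\},$$ with convergence in the norms and $(g,\gamma)\neq(f,\mu)$. *)

(* Defs.v *)
From HB Require Import structures.
From mathcomp Require Import all_boot all_order all_algebra.
From mathcomp Require Import all_classical all_reals all_analysis.

Set Implicit Arguments.
Unset Strict Implicit.
Unset Printing Implicit Defensive.

Import Order.TTheory GRing.Theory Num.Theory.
Import numFieldNormedType.Exports.

Local Open Scope classical_set_scope.
Local Open Scope ring_scope.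

Definition I01 (R : realType) : Type := set_type (`[0, 1]%classic : set R).

Definition I01_zero (R : realType) : I01 R.
Proof. by exists 0; rewrite inE /= in_itv /= lexx ler01. Defined.

HB.instance Definition _ (R : realType) :=
  PseudoMetric.copy (I01 R) (set_type (`[0, 1]%classic : set R)).
HB.instance Definition _ (R : realType) := isPointed.Build (I01 R) (I01_zero R).
HB.instance Definition _ (R : realType) :=
  Measurable.copy (I01 R) (g_sigma_algebraType (@open (I01 R))).

Lemma I01_open_measurable (R : realType) (U : set (I01 R)) :
  open U -> measurable U.
Proof. by move=> oU; apply: sub_sigma_algebra. Qed.

Lemma I01_compact (R : realType) : compact [set: I01 R].
Proof.
move=> F PF _.
pose G : set_system R := (fun x : I01 R => val x) @ F.
have PG : ProperFilter G by exact: fmap_proper_filter.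
have [|p [pI clp]] := @segment_compact R 0 1 G PG.
  by apply: (@filterS _ F _ setT) filterT => x _; exact: set_mem (valP x).
exists (exist _ p (mem_set pI)); split => //.
move=> A B FA [_ [[W oW <-] /= Wp WB]].
have : G [set val x | x in A].
  by apply: (@filterS _ F _ A) FA => x Ax /=; exists x.
move=> /clp /(_ (open_nbhs_nbhs (conj oW Wp))) [y [[x Ax <-] Wx]].
by exists x; split => //; exact: WB.
Qed.

Section C01.
Variable R : realType.

Definition continuous_pred : {pred (I01 R -> R^o)} :=
  fun f => `[< continuous f >].

Record C01 := MkC01 { C01_fun :> I01 R -> R^o ; _ : C01_fun \in continuous_pred }.

HB.instance Definition _ := [isSub for C01_fun].
HB.instance Definition _ := [Choice of C01 by <:].

Lemma continuous_pred_submod : submod_closed continuous_pred.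
Proof.
split; first by apply/asboolP; exact: (@cst_continuous _ R^o 0).
move=> a f g /asboolP cf /asboolP cg; apply/asboolP => x.
by apply: continuousD; [apply: continuousZl_tmp; exact: cf|exact: cg].
Qed.

HB.instance Definition _ := GRing.isSubmodClosed.Build R (I01 R -> R^o)
  continuous_pred continuous_pred_submod.
HB.instance Definition _ := [SubChoice_isSubLmodule of C01 by <:].

Lemma C01_continuous (f : C01) : continuous (f : I01 R -> R).
Proof. by have /asboolP := valP f. Qed.

(* The supremum is attained, since [0,1] is compact. *)
Definition C01_norm (f : C01) : R := sup [set `|f t| | t in [set: I01 R]].

Lemma C01_has_sup (f : C01) : has_sup [set `|f t| | t in [set: I01 R]].
Proof.
split; first by exists `|f (I01_zero R)|, (I01_zero R).
have /compact_bounded[M [_ Mf]] : compact (f @` [set: I01 R]).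
  apply: continuous_compact; last exact: I01_compact.
  exact/continuous_subspaceT/C01_continuous.
exists (`|M| + 1) => _ [t _ <-]; apply: (Mf (`|M| + 1)); last by exists t.
by rewrite ltr_pwDr// ler_norm.
Qed.

Lemma C01_norm_ub (f : C01) t : `|f t| <= C01_norm f.
Proof. by apply: sup_upper_bound; [exact: C01_has_sup|exists t]. Qed.

Lemma C01_norm_le (f : C01) M : (forall t, `|f t| <= M) -> C01_norm f <= M.
Proof.
move=> fM; apply: ge_sup; first by case: (C01_has_sup f).
by move=> _ [t _ <-].
Qed.

Lemma C01_normD (f g : C01) : C01_norm (f + g) <= C01_norm f + C01_norm g.
Proof.
apply: C01_norm_le => t; apply: le_trans (ler_normD (f t) (g t)) _.
by apply: lerD; exact: C01_norm_ub.
Qed.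

Lemma C01_normZ (a : R) (f : C01) : C01_norm (a *: f) = `|a| * C01_norm f.
Proof.
have le b (h : C01) : C01_norm (b *: h) <= `|b| * C01_norm h.
  apply: C01_norm_le => t; rewrite [X in `|X|](_ : _ = b * h t)// normrM.
  by rewrite ler_wpM2l// C01_norm_ub.
apply/eqP; rewrite eq_le le /=.
have [->|a0] := eqVneq a 0.
  rewrite normr0 mul0r; apply: le_trans (C01_norm_ub _ (I01_zero R)).
  exact: normr_ge0.
rewrite -ler_pdivlMl ?normr_gt0// -normfV.
by rewrite -[X in C01_norm X <= _](scalerK a0); exact: le.
Qed.

Lemma C01_norm0_eq0 (f : C01) : C01_norm f = 0 -> f = 0.
Proof.
move=> f0; apply/val_inj/funext => t; apply/eqP; rewrite -normr_le0 -f0.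
exact: C01_norm_ub.
Qed.

HB.instance Definition _ := Lmodule_isNormed.Build R C01
  C01_normD C01_normZ C01_norm0_eq0.

Lemma C01_normE (f : C01) : `|f| = sup [set `|f t| | t in [set: I01 R]].
Proof. by []. Qed.

Lemma C01_measurable (f : C01) : measurable_fun [set: I01 R] (f : I01 R -> R).
Proof.
apply: (measurability _ (measurable_realfun.RGenOpens.measurableE R)).
move=> _ [_ [a [b ->] <-]]; rewrite setTI; apply: I01_open_measurable.
by have /continuousP := @C01_continuous f; apply; exact: interval_open.
Qed.

Lemma C01_integrable (mu : {finite_measure set (I01 R) -> \bar R}) (f : C01) :
  mu.-integrable [set: I01 R] (EFin \o (f : I01 R -> R)).
Proof.
apply: measurable_bounded_integrable => //.
- exact: fin_num_fun_lty.
- exact: C01_measurable.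
- exists `|f|; split; first exact: num_real.
  by move=> M fM t _; apply: le_trans (C01_norm_ub f t) (ltW fM).
Qed.

End C01.

Section rca.
Variable R : realType.
Local Notation I := (I01 R).

(* Regularity in the sense of Dunford and Schwartz. *)
Definition regular_charge (m : set I -> R) :=
  forall E, measurable E -> forall e, 0 < e -> exists K U : set I,
    [/\ closed K, open U, K `<=` E, E `<=` U &
      forall A, measurable A -> A `<=` U `\` K -> `|m A| < e].

(* Elements of rca[0,1] are represented by set functions on all subsets of
   [0,1]; the value 0 outside the Borel sets is a normalization that makes
   Leibniz equality of representatives equality of measures. *)
Definition rca_pred : {pred (set I -> R^o)} := fun m =>
  `[< [/\ m set0 = 0, semi_sigma_additive (fun A => (m A)%:E),
          regular_charge m & forall A, ~ measurable A -> m A = 0] >].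

Record rca := MkRca { rca_fun :> set I -> R^o ; _ : rca_fun \in rca_pred }.

HB.instance Definition _ := [isSub for rca_fun].
HB.instance Definition _ := [Choice of rca by <:].

Lemma semi_sigma_additive_EFin (m : set I -> R) :
  semi_sigma_additive (fun A => (m A)%:E) <->
  (forall F : (set I)^nat, (forall i, measurable (F i)) -> trivIset setT F ->
    measurable (\bigcup_n F n) ->
    (fun n => \sum_(0 <= i < n) m (F i)) @ \oo --> m (\bigcup_n F n)).
Proof.
split => h F mF tF mUF.
- have /fine_cvg := h F mF tF mUF.
  by apply: cvg_trans; apply: near_eq_cvg; apply: nearW => n /=; rewrite sumEFin.
- under eq_fun do rewrite sumEFin.
  by apply: cvg_EFin; [exact: nearW|exact: h].
Qed.

Lemma rca_pred_submod : submod_closed rca_pred.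
Proof.
split.
  apply/asboolP; split => //.
  - apply/semi_sigma_additive_EFin => F _ _ _.
    under eq_fun do rewrite big1//.
    exact: cvg_cst.
  - move=> E mE e e0.
    exists set0, setT; split => //.
    - exact: closed0.
    - exact: openT.
    - by move=> A _ _; rewrite normr0.
move=> a f g /asboolP[f0 /semi_sigma_additive_EFin fs fr fn].
move=> /asboolP[g0 /semi_sigma_additive_EFin gs gr gn].
have fgE A : (a *: f + g) A = a * f A + g A by [].
apply/asboolP; split.
- by rewrite fgE f0 g0 mulr0 addr0.
- apply/semi_sigma_additive_EFin => F mF tF mUF; rewrite fgE.
  under eq_fun do rewrite big_split/= -mulr_sumr.
  apply: cvgD; last exact: gs.
  by apply: cvgM; [exact: cvg_cst|exact: fs].
- move=> E mE e e0.
  have e2 : 0 < e / 2 by rewrite divr_gt0.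
  have d0 : 0 < (e / 2) / (`|a| + 1) by rewrite divr_gt0// ltr_wpDl.
  have [K1 [U1 [cK1 oU1 K1E EU1 h1]]] := fr E mE _ d0.
  have [K2 [U2 [cK2 oU2 K2E EU2 h2]]] := gr E mE _ e2.
  exists (K1 `|` K2), (U1 `&` U2); split.
  + exact: closedU.
  + exact: openI.
  + by move=> x [/K1E|/K2E].
  + by move=> x Ex; split; [exact: EU1|exact: EU2].
  + move=> A mA AUK; rewrite fgE [e]splitr.
    apply: le_lt_trans (ler_normD _ _) _; apply: ler_ltD; last first.
      by apply: h2 => // x /AUK[[_ ?] nK]; split => // ?; apply: nK; right.
    rewrite normrM.
    have /ltW : `|f A| < e / 2 / (`|a| + 1).
      by apply: h1 => // x /AUK[[? _] nK]; split => // ?; apply: nK; left.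
    rewrite ler_pdivlMr ?ltr_wpDl// mulrC; apply: le_trans.
    by rewrite ler_wpM2r// lerDl.
- by move=> A nA; rewrite fgE fn// gn// mulr0 addr0.
Qed.

HB.instance Definition _ := GRing.isSubmodClosed.Build R (set I -> R^o)
  rca_pred rca_pred_submod.
HB.instance Definition _ := [SubChoice_isSubLmodule of rca by <:].

Definition rca_charge (m : rca) : set I -> \bar R := fun A => (m A)%:E.

Lemma rca_charge0 (m : rca) : rca_charge m set0 = 0%E.
Proof. by have /asboolP[m0 _ _ _] := valP m; rewrite /rca_charge m0. Qed.

Lemma rca_charge_fin (m : rca) A : measurable A -> rca_charge m A \is a fin_num.
Proof. by []. Qed.

Lemma rca_charge_sigma_additive (m : rca) : semi_sigma_additive (rca_charge m).
Proof. by have /asboolP[_ ? _ _] := valP m. Qed.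

HB.instance Definition _ (m : rca) := isCharge.Build _ I R (rca_charge m)
  (rca_charge0 m) (@rca_charge_fin m) (@rca_charge_sigma_additive m).

Definition rca_pos_set (m : rca) : set I :=
  sval (cid (Hahn_decomposition (rca_charge m))).
Definition rca_neg_set (m : rca) : set I :=
  sval (cid (svalP (cid (Hahn_decomposition (rca_charge m))))).
Definition rca_hahn (m : rca) :
    hahn_decomposition (rca_charge m) (rca_pos_set m) (rca_neg_set m) :=
  svalP (cid (svalP (cid (Hahn_decomposition (rca_charge m))))).

Definition rca_pos (m : rca) : {finite_measure set I -> \bar R} :=
  jordan_pos (rca_hahn m).
Definition rca_neg (m : rca) : {finite_measure set I -> \bar R} :=
  jordan_neg (rca_hahn m).

(* The value does not depend on the chosen Hahn decomposition: it is the
   supremum over finite measurable partitions (rca_norm_total_variation). *)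
Definition rca_norm (m : rca) : R :=
  fine (charge_variation (rca_hahn m) [set: I]).

Lemma rca_jordan (m : rca) A : measurable A ->
  m A = fine (rca_pos m A) - fine (rca_neg m A).
Proof.
move=> mA; have := jordan_decomp (rca_hahn m) mA.
rewrite /cadd/= cscaleN1 => mE; apply: EFin_inj.
rewrite EFinB !fineK; [exact: mE|exact: fin_num_measure..].
Qed.

Lemma rca_fun_le (m : rca) A : measurable A ->
  `|m A| <= fine (charge_variation (rca_hahn m) A).
Proof.
move=> mA; rewrite -lee_fin fineK; last exact: fin_num_measure.
exact: (abse_charge_variation (rca_hahn m) mA).
Qed.

Lemma rca_norm_jordan (m : rca) :
  rca_norm m = fine (rca_pos m setT) + fine (rca_neg m setT).
Proof. by rewrite /rca_norm /charge_variation fineD//; exact: fin_num_measure. Qed.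

Lemma rca_norm_ub (m : rca) n (A : nat -> set I) :
  (forall i, measurable (A i)) -> trivIset setT A ->
  \sum_(i < n) `|m (A i)| <= rca_norm m.
Proof.
move=> mA tA; pose v : {measure set I -> \bar R} := charge_variation (rca_hahn m).
apply: (@le_trans _ _ (\sum_(i < n) fine (v (A i)))).
  by apply: ler_sum => i _; exact: rca_fun_le.
have vfin B : measurable B -> v B \is a fin_num.
  by move=> mB; exact: (fin_num_measure (charge_variation (rca_hahn m))).
rewrite -lee_fin -sumEFin [leRHS](_ : _ = v setT); last by rewrite fineK ?vfin.
under eq_bigr do rewrite fineK ?vfin//.
rewrite -measure_semi_additive//; last exact: bigsetU_measurable.
by apply: le_measure; rewrite ?inE//; exact: bigsetU_measurable.
Qed.

Lemma rca_norm_hahn (m : rca) :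
  rca_norm m = `|m (rca_pos_set m)| + `|m (rca_neg_set m)|.
Proof.
have [[mP P0] [mN N0] PN PN0] := rca_hahn m.
have mP0 : 0 <= m (rca_pos_set m) by rewrite -lee_fin; exact: P0.
have mN0 : m (rca_neg_set m) <= 0 by rewrite -lee_fin; exact: N0.
rewrite rca_norm_jordan ger0_norm// ler0_norm//; congr (_ + _).
  rewrite [rca_pos m _](jordan_posE (rca_hahn m) setT) cjordan_posE.
  by rewrite /crestr0 mem_set//= /crestr setTI.
rewrite [rca_neg m _](jordan_negE (rca_hahn m) setT) cjordan_negE.
by rewrite /crestr0 mem_set//= /crestr setTI.
Qed.

Lemma rca_norm_total_variation (m : rca) : rca_norm m =
  sup [set x | exists n (A : nat -> set I),
    [/\ forall i, measurable (A i), trivIset setT A &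
      x = \sum_(i < n) `|m (A i)|]].
Proof.
set V := (X in sup X).
have Vub : ubound V (rca_norm m).
  by move=> _ [n [A [mA tA ->]]]; exact: rca_norm_ub.
apply/eqP; rewrite eq_le; apply/andP; split; last first.
  apply: ge_sup => //; exists 0, 0%N, (fun=> set0); split => //.
    by apply/trivIsetP => i j _ _ _; rewrite set0I.
  by rewrite big_ord0.
apply: ub_le_sup; first by exists (rca_norm m).
have [[mP _] [mN _] _ PN0] := rca_hahn m.
exists 2%N, (bigcup2 (rca_pos_set m) (rca_neg_set m)); split.
- by case=> [|[|i]]; [exact: mP|exact: mN|exact: measurable0].
- by rewrite -trivIset_bigcup2.
- by rewrite 2!big_ord_recl big_ord0 addr0 rca_norm_hahn.
Qed.

Lemma rca_norm_ub2 (m : rca) A B : measurable A -> measurable B ->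
  A `&` B = set0 -> `|m A| + `|m B| <= rca_norm m.
Proof.
move=> mA mB AB0.
have := @rca_norm_ub m 2 (bigcup2 A B) _ _.
rewrite 2!big_ord_recl big_ord0 addr0; apply.
  by case=> [|[|i]]; [exact: mA|exact: mB|exact: measurable0].
by rewrite -trivIset_bigcup2.
Qed.

Lemma rca_normD (m n : rca) : rca_norm (m + n) <= rca_norm m + rca_norm n.
Proof.
have [[mP _] [mN _] _ PN0] := rca_hahn (m + n).
rewrite rca_norm_hahn.
set P := rca_pos_set _; set N := rca_neg_set _.
apply: (@le_trans _ _ ((`|m P| + `|n P|) + (`|m N| + `|n N|))).
  by apply: lerD; exact: ler_normD.
by rewrite addrACA lerD// rca_norm_ub2.
Qed.

Lemma rca_normZ (a : R) (m : rca) : rca_norm (a *: m) = `|a| * rca_norm m.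
Proof.
have le b (h : rca) : rca_norm (b *: h) <= `|b| * rca_norm h.
  have [[mP _] [mN _] _ PN0] := rca_hahn (b *: h).
  rewrite rca_norm_hahn.
  set P := rca_pos_set _; set N := rca_neg_set _.
  rewrite [X in `|X| + _](_ : _ = b * h P)// [X in _ + `|X|](_ : _ = b * h N)//.
  by rewrite !normrM -mulrDr ler_wpM2l// rca_norm_ub2.
apply/eqP; rewrite eq_le le /=.
have [->|a0] := eqVneq a 0.
  by rewrite normr0 mul0r rca_norm_hahn addr_ge0.
rewrite -ler_pdivlMl ?normr_gt0// -normfV.
by rewrite -[X in rca_norm X <= _](scalerK a0); exact: le.
Qed.

Lemma rca_norm0_eq0 (m : rca) : rca_norm m = 0 -> m = 0.
Proof.
move=> m0; apply/val_inj/funext => A; have /asboolP[_ _ _ mn] := valP m.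
have [mA|/mn//] := pselect (measurable A).
apply/eqP; rewrite -normr_le0 -m0.
have := @rca_norm_ub2 m A set0 mA measurable0 (setI0 _).
by apply: le_trans; rewrite lerDl.
Qed.

HB.instance Definition _ := Lmodule_isNormed.Build R rca
  rca_normD rca_normZ rca_norm0_eq0.

End rca.

Lemma measure_add_fin d (T : measurableType d) (R : realType)
    (p q : {finite_measure set T -> \bar R}) : fin_num_fun (measure_add p q).
Proof.
by move=> A mA; rewrite measure_addE fin_numD !fin_num_measure.
Qed.

HB.instance Definition _ d (T : measurableType d) (R : realType)
    (p q : {measure set T -> \bar R}) :=
  Measure.copy (measure_add p q) (msum (fun n => if n is 0%N then p else q) 2).

HB.instance Definition _ d (T : measurableType d) (R : realType)
    (p q : {finite_measure set T -> \bar R}) :=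
  @Measure_isFinite.Build d T R (measure_add p q) (measure_add_fin p q).

Section pairing.
Variable R : realType.
Local Notation I := (I01 R).
Implicit Types (m n : rca R) (f g : C01 R).

Definition pairing m f : R :=
  \int[rca_pos m]_(s in [set: I]) f s - \int[rca_neg m]_(s in [set: I]) f s.

Lemma Rintegral_measure_add (p q : {finite_measure set I -> \bar R}) f :
  \int[measure_add p q]_(s in [set: I]) f s =
  \int[p]_(s in [set: I]) f s + \int[q]_(s in [set: I]) f s.
Proof.
have ip := C01_integrable p f; have iq := C01_integrable q f.
rewrite /Rintegral (integral_measure_add measurableT ip iq) fineD//.
- exact: (integrable_fin_num measurableT ip).
- exact: (integrable_fin_num measurableT iq).
Qed.

Lemma pairing_jordan m f (p q : {finite_measure set I -> \bar R}) :
  (forall A, measurable A -> m A = fine (p A) - fine (q A)) ->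
  pairing m f = \int[p]_(s in [set: I]) f s - \int[q]_(s in [set: I]) f s.
Proof.
move=> mpq; apply/eqP; rewrite /pairing subr_eq addrAC eq_sym subr_eq eq_sym.
rewrite -!Rintegral_measure_add; apply/eqP; congr fine.
apply: eq_measure_integral => A mA _.
have e := mpq A mA; rewrite rca_jordan// in e.
have {}e : fine (rca_pos m A) + fine (q A) = fine (p A) + fine (rca_neg m A).
  by apply/eqP; rewrite -subr_eq addrAC e subrK.
have fE (r : {finite_measure set I -> \bar R}) : r A = (fine (r A))%:E.
  by rewrite fineK//; exact: fin_num_measure.
apply: etrans (measure_addE _ _ A) _; apply: etrans (esym (measure_addE _ _ A)).
suff : (rca_pos m A + q A = p A + rca_neg m A)%E by [].
by rewrite (fE (rca_pos m)) (fE q) (fE p) (fE (rca_neg m)) -!EFinD e.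
Qed.

Lemma pairingD m n f : pairing (m + n) f = pairing m f + pairing n f.
Proof.
have fin (p q : {finite_measure set I -> \bar R}) A : measurable A ->
    fine (measure_add p q A) = fine (p A) + fine (q A).
  by move=> mA; rewrite measure_addE fineD//; exact: fin_num_measure.
rewrite (@pairing_jordan (m + n) f
  (measure_add (rca_pos m) (rca_pos n)) (measure_add (rca_neg m) (rca_neg n))).
  by rewrite !Rintegral_measure_add /pairing opprD addrACA.
move=> A mA; rewrite !fin// opprD addrACA.
by rewrite -!rca_jordan.
Qed.

Lemma Rintegral_mscale (k : {nonneg R}) (p : {finite_measure set I -> \bar R}) f :
  \int[mscale k p]_(s in [set: I]) f s =
  k%:num * \int[p]_(s in [set: I]) f s.
Proof.
have ip := C01_integrable p f.
have /integrableP[mf _] := ip.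
rewrite /Rintegral integralE ge0_integral_mscale//; last exact: measurable_realfun.measurable_funepos.
rewrite ge0_integral_mscale//; last exact: measurable_realfun.measurable_funeneg.
rewrite -muleBr//; last first.
  apply: fin_num_adde_defr; apply: integrable_fin_num => //.
  exact: integrable_funepos.
rewrite -integralE fineM//; exact: integrable_fin_num.
Qed.

Lemma pairingN m f : pairing (- m) f = - pairing m f.
Proof.
rewrite (@pairing_jordan (- m) f (rca_neg m) (rca_pos m)) ?opprB//.
by move=> A mA; rewrite -[LHS]/(- (m A)) rca_jordan// opprB.
Qed.

Lemma pairingZ (a : R) m f : pairing (a *: m) f = a * pairing m f.
Proof.
have pos (b : {nonneg R}) n : pairing (b%:num *: n) f = b%:num * pairing n f.
  rewrite (@pairing_jordan _ f (mscale b (rca_pos n)) (mscale b (rca_neg n))).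
    by rewrite !Rintegral_mscale mulrBr.
  move=> A mA; rewrite -[LHS]/(b%:num * n A) rca_jordan// mulrBr /mscale.
  by rewrite !fineM//; exact: fin_num_measure.
have [a0|a0] := leP 0 a; first exact: (pos (NngNum a0)).
have Na0 : 0 <= - a by rewrite oppr_ge0 ltW.
have /= := pos (NngNum Na0) m.
by rewrite scaleNr pairingN mulNr => /oppr_inj.
Qed.

Lemma pairing_le m f : `|pairing m f| <= `|m| * `|f|.
Proof.
have le (p : {finite_measure set I -> \bar R}) :
    `|\int[p]_(s in [set: I]) f s| <= `|f| * fine (p setT).
  have ip := C01_integrable p f.
  apply: le_trans (le_normr_Rintegral measurableT ip) _.
  rewrite -Rintegral_cst//; apply: le_Rintegral => //.
  - exact: (integrable_norm ip).
  - exact: finite_measure_integrable_cst.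
  - by move=> t _; exact: C01_norm_ub.
rewrite [leRHS]mulrC [`|m|]rca_norm_jordan mulrDr.
by apply: le_trans (ler_normB _ _) _; exact: lerD.
Qed.

End pairing.

Record dual (R : realType) (V : normedModType R) := MkDual {
  dual_fun :> {linear V -> R^o} ;
  dual_continuous : continuous dual_fun }.

Section bidual.
Variable R : realType.
Variable f : C01 R.

Definition eval_C01 (m : rca R) : R^o := pairing m f.

Lemma eval_C01_is_linear : linear eval_C01.
Proof. by move=> a m n; rewrite /eval_C01 pairingD pairingZ. Qed.

HB.instance Definition _ := GRing.isLinear.Build R (rca R) R^o _ eval_C01
  eval_C01_is_linear.

Lemma eval_C01_continuous : continuous eval_C01.
Proof.
apply: bounded_linear_continuous; apply/linear_boundedP.
near=> r => m /=; apply: le_trans (pairing_le m f) _.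
by rewrite mulrC ler_wpM2r//; near: r; exact: nbhs_pinfty_ge.
Unshelve. all: by end_near. Qed.

Definition bidual_of : dual (rca R) :=
  @MkDual R (rca R) eval_C01 eval_C01_continuous.

End bidual.

Section duality_mapping.
Variable R : realType.
Implicit Types (f u : C01 R) (mu : rca R).

Definition C01_nonneg : set (C01 R) := [set f | forall s, 0 <= f s].

Definition maximizing_set f : set (I01 R) := [set t | `|f t| = `|f|].

Definition duality_map f : set (rca R) :=
  [set mu | pairing mu f = `|f| ^+ 2 /\ `|f| ^+ 2 = `|mu| ^+ 2].

(* The Mordukhovich derivative of the duality mapping J at (f, mu); the limsup
   is along the punctured neighbourhoods of (f, mu) traced on the graph of J. *)
Definition Mordukhovich_duality_map f mu (Phi : dual (rca R)) : set (rca R) :=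
  [set lambda | (limf_esup
    (fun p : C01 R * rca R =>
      ((pairing lambda (p.1 - f) - Phi (p.2 - mu)) /
       (`|p.1 - f| + `|p.2 - mu|))%:E)
    (within [set p | duality_map p.1 p.2] (f, mu)^') <= 0)%E].

End duality_mapping.

(* Main.v *)
Require Import Defs.
From mathcomp Require Import all_boot all_order all_algebra.
From mathcomp Require Import all_classical all_reals all_analysis.

(** Pick a common maximizing point t of f and u.  As f and u are nonnegative,
    f t = |f| and u t = |u|, so the point masses mu = |f| delta_t and
    lambda = |u| delta_t belong to J(f) and J(u).

    The graph of J is a cone, hence it contains the whole ray through (f, mu),
    and (f, mu) can be approached radially, by ((1 + s) f, (1 + s) mu) with
    s > 0 tending to 0.  Along that ray the quotient defining the Mordukhovich
    derivative is constant:
      (s |u| |f| - s |f|^2) / (s |f| + s |f|) = (|u| - |f|) / 2,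
    which is positive since |u| > |f|.  The upper limit is therefore at least
    (|u| - |f|) / 2, and lambda is not in the derivative at f**. *)

Import Order.TTheory GRing.Theory Num.Theory.
Import numFieldNormedType.Exports.

Local Open Scope classical_set_scope.
Local Open Scope ring_scope.

Section point_mass.
Set Implicit Arguments.
Unset Strict Implicit.
Variables (R : realType) (t : I01 R).
Local Notation I := (I01 R).

(** Elements of [rca R] vanish off the Borel sets, whence the cut-off of the
    Dirac measure by measurability. *)
Definition point_mass_fun (A : set I) : R^o :=
  if `[< measurable A >] then \1_A t else 0.

Lemma point_mass_funE (A : set I) : measurable A -> point_mass_fun A = \1_A t.
Proof. by move=> mA; rewrite /point_mass_fun asboolT. Qed.

Lemma point_mass_fun_dirac (A : set I) : measurable A ->
  (point_mass_fun A)%:E = (\d_t A : \bar R).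
Proof. by move=> mA; rewrite point_mass_funE// diracE indicE. Qed.

Lemma I01_closed1 : closed [set t].
Proof.
rewrite [X in closed X](_ : _ = (val : I -> R) @^-1` [set val t]).
  apply: preimage_closed => [x _|]; first exact: initial_continuous.
  exact: closed_eq.
by apply/seteqP; split => x /= => [->//|/val_inj].
Qed.

(** If t lies in E, take K to be the singleton of t and U the whole space;
    otherwise K is empty and U omits t.  Either way t is outside the difference
    U \ K, which is therefore null. *)
Lemma point_mass_fun_regular : regular_charge point_mass_fun.
Proof.
move=> E mE e e0.
have small (A : set I) : measurable A -> ~ A t -> `|point_mass_fun A| < e.
  by move=> mA nAt; rewrite point_mass_funE// indicE memNset// normr0.
have [Et|nEt] := pselect (E t).
  exists [set t], setT; split => //.
  - exact: I01_closed1.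
  - exact: openT.
  - by move=> _ ->.
  - by move=> A mA AU; apply: small => // /AU[_]; apply.
exists set0, (~` [set t]); split => //.
- exact: closed0.
- by rewrite openC; exact: I01_closed1.
- by move=> x Ex xt; apply: nEt; rewrite -xt.
- by move=> A mA AU; apply: small => // /AU[ntt _]; exact: ntt.
Qed.

Lemma point_mass_fun_rca : point_mass_fun \in @rca_pred R.
Proof.
apply/asboolP; split.
- by rewrite point_mass_funE// indicE in_set0.
- move=> F mF tF mUF; rewrite point_mass_fun_dirac//.
  under eq_fun do under eq_bigr do rewrite point_mass_fun_dirac//.
  exact: measure_semi_sigma_additive.
- exact: point_mass_fun_regular.
- by move=> A nA; rewrite /point_mass_fun asboolF.
Qed.

Definition point_mass : rca R := MkRca point_mass_fun_rca.

Lemma pairing_point_mass (f : C01 R) : pairing point_mass f = f t.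
Proof.
rewrite (@pairing_jordan R _ f (\d_t) mzero) => [|A mA]; last first.
  by rewrite [LHS]point_mass_funE//= subr0.
rewrite /Rintegral integral_measure_zero subr0 integral_dirac//.
  by rewrite diracT mul1e.
apply/measurable_realfun.measurable_EFinP; exact: C01_measurable.
Qed.

(** Exactly one of the two sets of a Hahn decomposition contains t. *)
Lemma norm_point_mass : `|point_mass| = 1.
Proof.
have [[mP _] [mN _] PN PN0] := rca_hahn point_mass.
rewrite [LHS]rca_norm_hahn [point_mass _]point_mass_funE//.
rewrite [point_mass _]point_mass_funE// !indicE !normr_nat.
have [Pt|Nt] : (rca_pos_set point_mass `|` rca_neg_set point_mass) t.
  by rewrite PN.
- rewrite (mem_set Pt) memNset ?addr0// => Nt.
  by have : set0 t by rewrite -PN0.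
- rewrite (mem_set Nt) memNset ?add0r// => Pt.
  by have : set0 t by rewrite -PN0.
Qed.

End point_mass.

Section duality.
Set Implicit Arguments.
Unset Strict Implicit.
Variable R : realType.
Implicit Types (f u : C01 R) (mu : rca R).

Lemma maximizing_nonneg f t :
  C01_nonneg f -> maximizing_set f t -> f t = `|f|.
Proof. by move=> f0 <-; rewrite ger0_norm. Qed.

Lemma duality_map_point_mass f t : C01_nonneg f -> maximizing_set f t ->
  duality_map f (`|f| *: point_mass t).
Proof.
move=> f0 ft; split.
  by rewrite pairingZ pairing_point_mass (maximizing_nonneg f0 ft) expr2.
by rewrite normrZ norm_point_mass mulr1 normr_id.
Qed.

Lemma pairingZr (a : R) mu f : pairing mu (a *: f) = a * pairing mu f.
Proof.
have RZ (p : {finite_measure set (I01 R) -> \bar R}) :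
    \int[p]_(s in [set: I01 R]) (a *: f) s =
    a * \int[p]_(s in [set: I01 R]) f s.
  by rewrite -RintegralZl//; exact: C01_integrable.
by rewrite /pairing !RZ mulrBr.
Qed.

Lemma duality_mapZ (a : R) f mu :
  duality_map f mu -> duality_map (a *: f) (a *: mu).
Proof.
move=> [fmu nfmu]; split.
  by rewrite pairingZ pairingZr fmu normrZ exprMn real_normK ?num_real// mulrA.
by rewrite !normrZ !exprMn nfmu.
Qed.

(** Since x <> 0, the points of the ray other than (x, y) lie in the punctured
    neighbourhood and tend to (x, y), so every set of the filter contains one of
    them; thus the value c bounds each of the suprema whose infimum is the upper
    limit. *)
Lemma limf_esup_radial_ge (V W : normedModType R) (S : set (V * W))
    (x : V) (y : W) (h : V * W -> \bar R) (c : \bar R) :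
    x != 0 ->
    (forall s : R, 0 < s -> S ((1 + s) *: x, (1 + s) *: y)) ->
    (forall s : R, 0 < s -> h ((1 + s) *: x, (1 + s) *: y) = c) ->
  (c <= limf_esup h (within S (x, y)^'))%E.
Proof.
move=> x0 rayS rayh; apply: le_ereal_inf_tmp => _ [A FA <-].
have ray_cvg : ((1 + s) *: x, (1 + s) *: y) @[s --> (0 : R)] --> (x, y).
  have cvg1D : (1 + s) @[s --> (0 : R)] --> (1 : R).
    rewrite -[X in _ --> X]addr0.
    by apply: cvgD; [exact: cvg_cst|exact: cvg_id].
  have ray1 (U : normedModType R) (z : U) : (1 + s) *: z @[s --> (0 : R)] --> z.
    by rewrite -[X in _ --> X]scale1r; exact: cvgZr_tmp.
  exact: cvg_pair (ray1 _ x) (ray1 _ y).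
have [s s0 As] : exists2 s : R, 0 < s & A ((1 + s) *: x, (1 + s) *: y).
  have ray0 : \forall s \near (0 : R)^'+,
      ((1 + s) *: x, (1 + s) *: y) != (x, y) ->
      S ((1 + s) *: x, (1 + s) *: y) -> A ((1 + s) *: x, (1 + s) *: y).
    by apply: cvg_at_right_filter ray_cvg _ FA.
  have [s [s0 As]] : exists s : R, 0 < s /\
      (((1 + s) *: x, (1 + s) *: y) != (x, y) ->
       S ((1 + s) *: x, (1 + s) *: y) -> A ((1 + s) *: x, (1 + s) *: y)).
    apply: (@filter_ex _ (0 : R)^'+); apply: filterI ray0.
    exact: nbhs_right_gt.
  exists s => //; apply: As (rayS s s0).
  rewrite xpair_eqE negb_and scalerDl scale1r -subr_eq0 addrC addKr.
  by rewrite scaler_eq0 gt_eqF// (negPf x0).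
by apply: ereal_sup_ubound; exists ((1 + s) *: x, (1 + s) *: y); rewrite ?rayh.
Qed.

End duality.

Theorem theorem5p6 (R : realType) (f : C01 R) :
  C01_nonneg f -> 0 < `|f| ->
  forall u : C01 R, C01_nonneg u -> `|f| < `|u| ->
    maximizing_set u `&` maximizing_set f !=set0 ->
    exists mu lambda : rca R,
      [/\ duality_map f mu, duality_map u lambda &
          ~ Mordukhovich_duality_map f mu (bidual_of f) lambda].
Proof.
move=> f0 f_gt0 u u0 fu [t [ut ft]].
have Jf := duality_map_point_mass f0 ft.
exists (`|f| *: point_mass t), (`|u| *: point_mass t).
split; [exact: Jf|exact: duality_map_point_mass|].
apply/negP; rewrite -ltNge.
apply: (@lt_le_trans _ _ ((`|u| - `|f|) / 2)%:E).
  by rewrite lte_fin divr_gt0// subr_gt0.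
apply: limf_esup_radial_ge => [|s _|s s0]; first by rewrite -normr_gt0.
- exact: duality_mapZ.
have incr (V : lmodType R) (v : V) : (1 + s) *: v - v = s *: v.
  by rewrite scalerDl scale1r addrAC subrr add0r.
rewrite /= !incr /eval_C01 pairingZr !pairingZ !pairing_point_mass.
rewrite (maximizing_nonneg f0 ft) !normrZ norm_point_mass normr_id mulr1.
rewrite (gtr0_norm s0); congr EFin.
have sf : s * `|f| != 0 by rewrite mulf_neq0// gt_eqF.
rewrite -mulrBr -mulrBl [(_ - _) * _]mulrC mulrA -mulr2n.
by rewrite -[in LHS]mulr_natr -mulf_div divff// mul1r.
Qed.
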